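(* Assume $T$ is locally finite, let $\nu$ be a positive Borel measure on $\partial T$ with $0<\nu(\partial T_x)<\infty$ for all $x\in T$, and let $\sigma$ be a positive measure on $T$. The following are equivalent: (i) $\sigma$ is a Carleson measure; (ii) for every $p\in(1,\infty)$ there is $C_p>0$ with $\|\mathcal Pf\|_{L^p(T,\sigma)}\le C_p\|f\|_{L^p(\partial T,\nu)}$ for all $f\in L^p(\partial T,\nu)$, and there is $C>0$ with $\|\mathcal Pf\|_{L^{1,\infty}(T,\sigma)}\le C\|f\|_{L^1(\partial T,\nu)}$ for all $f\in L^1(\partial T,\nu)$; (iii) for every $p\in(1,\infty)$ there is $C_p>0$ with $\|\mathcal Pf\|_{L^p(T,\sigma)}\le C_p\|\mathcal Pf\|_{H^p}$ for all $f\in L^p(\partial T,\nu)$.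
   Context: Let $T$ be a tree, identified with its vertex set, with graph distance $d$; $x\sim y$ means $d(x,y)=1$. Let $\Omega$ be the boundary (space of ends) of $T$; fix $\omega_*\in\Omega$ and set $\partial T=\Omega\setminus\{\omega_*\}$. For $x\in T$, $[x,\omega_* )$ is the geodesic ray from $x$ to $\omega_*$; for $\omega\in\partial T$, $(\omega,\omega_* )$ is the doubly infinite geodesic joining $\omega$ and $\omega_*$. For $y\in T$ write $x\le y$ if either $x\in T$ and $y\in[x,\omega_* )$, or $x\in\partial T$ and $y\in(x,\omega_* )$. Fix $o\in T$ and let $(x_j)_{j\ge0}$ enumerate $[o,\omega_* )$ with $x_0=o$, $x_j\sim x_{j+1}$; the level of $x\in T$ is $\ell(x)=\lim_{j\to\infty}(j-d(x,x_j))$. Sectors: $T_x=\{y\in T:y\le x\}$, $\partial T_x=\{\omega\in\partial T:\omega\le x\}$. $m_\nu(x)=\nu(\partial T_x)$. A positive measure on $T$ is a nonnegative function $\sigma$ on the vertices with $\sigma(E)=\sum_{x\in E}\sigma(x)$; $\|F\|_{L^{1,\infty}(T,\sigma)}=\sup_{\lambda>0}\lambda\,\sigma(\{x:|F(x)|>\lambda\})$. $\sigma$ is a Carleson measure if there is $C>0$ with $\sigma(T_x)\le C\nu(\partial T_x)$ for all $x\in T$. The Poisson integral is $\mathcal Pf(x)=\frac{1}{m_\nu(x)}\int_{\partial T_x}f\,d\nu$. The Laplacian is $\Delta F(x)=F(x)-\sum_{y\sim x,\ \ell(y)=\ell(x)-1}F(y)\frac{m_\nu(y)}{m_\nu(x)}$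 and $F$ is harmonic if $\Delta F\equiv0$; for harmonic $F$ and $1\le p<\infty$, $\|F\|_{H^p}^p=\sup_{k\in\mathbb Z}\sum_{\ell(x)=k}|F(x)|^pm_\nu(x)$ ($\mathcal Pf$ is harmonic). *)

(* Defs.v *)
From HB Require Import structures.
From mathcomp Require Import all_boot all_order all_algebra.
From mathcomp Require Import all_classical all_reals all_analysis.
Set Implicit Arguments. Unset Strict Implicit. Unset Printing Implicit Defensive.
Import Order.TTheory GRing.Theory Num.Theory.
Local Open Scope classical_set_scope.
Local Open Scope ring_scope.

(* A tree T with a distinguished end omega_star is encoded by its vertex type V
   and the "parent" map par : V -> V, where par x is the neighbour of x on the
   geodesic ray [x, omega_star ).  The edges of T are the pairs {x, par x}. *)

Section TreeDefs.
Variables (V : choiceType) (par : V -> V).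

Definition par_connected := forall x y : V, exists m n : nat,
  iter m par x = iter n par y.
Definition par_acyclic := forall (x : V) (n : nat), iter n.+1 par x <> x.
(* locally finite: every vertex has finitely many neighbours
   (par x and the finitely many children) *)
Definition par_locally_finite := forall x : V, finite_set [set y | par y = x].

Definition is_tree_with_end := par_connected /\ par_acyclic.

Variable o : V.

(* level l(x) = lim_j (j - d(x, x_j)) where x_j = par^j o; if
   par^m x = par^n o then l(x) = n - m. *)
Definition level (x : V) : int :=
  let mn := xget (0%N, 0%N) [set mn : nat * nat | iter mn.1 par x = iter mn.2 par o] in
  (mn.2%:Z - mn.1%:Z).

Definition sectorT (x : V) : set V := [set y | exists n : nat, iter n par y = x].

(* boundary dT = Omega \ {omega_star}: an end omega <> omega_star is identified with
   the doubly infinite geodesic (omega, omega_star), enumerated by level. *)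
Definition Bd := {w : int -> V | forall k : int,
  par (w k) = w (k + 1) /\ level (w k) = k}.

Definition sectorB (x : V) : set Bd := [set w | exists k : int, sval w k = x].

Definition sectors : set (set Bd) := [set sectorB x | x in [set: V]].

Section Pt.
Variable w0 : Bd.
Definition BdP (w : Bd) : Type := Bd.
HB.instance Definition _ := gen_eqMixin (BdP w0).
HB.instance Definition _ := gen_choiceMixin (BdP w0).
HB.instance Definition _ := isPointed.Build (BdP w0) w0.
(* Borel sigma-algebra on dT: generated by the (basic open) sectors dT_x *)
Definition BdM := g_sigma_algebraType (sectors : set (set (BdP w0))).
End Pt.
End TreeDefs.

Section Analysis.
Variables (R : realType) (V : choiceType) (par : V -> V) (o : V) (w0 : Bd par o).
Local Notation B := (BdM w0).
Variable nu : {measure set B -> \bar R}.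

Definition m_nu (x : V) : \bar R := nu (sectorB x : set B).

Definition Poisson (f : B -> R) (x : V) : R :=
  fine (\int[nu]_(w in (sectorB x : set B)) (f w)%:E) / fine (m_nu x).

Local Open Scope ereal_scope.
Definition smeas (sigma : V -> R) (E : set V) : \bar R :=
  \esum_(x in E) (sigma x)%:E.

Definition Carleson (sigma : V -> R) :=
  exists C : R, (0 < C)%R /\ forall x : V, smeas sigma (sectorT par x) <= C%:E * m_nu x.

Definition LpT (sigma : V -> R) (p : R) (F : V -> R) : \bar R :=
  (\esum_(x in [set: V]) ((`|F x| `^ p) * sigma x)%:E) `^ p^-1.

Definition LweakT (sigma : V -> R) (F : V -> R) : \bar R :=
  ereal_sup [set lam%:E * smeas sigma [set x | (lam < `|F x|)%R] | lam in [set lam : R | (0 < lam)%R]].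

Definition Hp (p : R) (F : V -> R) : \bar R :=
  (ereal_sup [set \esum_(x in [set x | level par o x = k]) ((`|F x| `^ p)%:E * m_nu x)
              | k in [set: int]]) `^ p^-1.
End Analysis.

(* Main.v *)
(* A Bellman-function induction on the depth below a vertex. With [m x] the mass
   of the boundary sector at [x], [u x = |int f|] over it, and
   [v_n x = m x + sigma(descendants of x of depth < n)], convexity of
   [u^p / v^(p-1)] gives
     [c * sum_(y below x, depth < n) sigma y * (u y / m y)^p + (u x)^p / (v_n x)^(p-1)
        <= sum_(y at depth n below x) m y * (u y / m y)^p],
   where the right-hand side is at most the p-th power of the [H^p] norm.  This
   bounds the [L^p(sigma)] norm directly by the [H^p] norm, without martingale
   convergence; Jensen's inequality then replaces the [H^p] norm by the [L^p] norm.
   The weak (1,1) bound is an induction on depth as well: if the average at [x]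
   exceeds the threshold, apply the Carleson condition at [x]; otherwise [x] is
   not counted and the bounds for its children add up. *)

Require Import Defs.
From HB Require Import structures.
From mathcomp Require Import all_boot all_order all_algebra finmap.
From mathcomp Require Import all_classical all_reals all_analysis.
From mathcomp Require Import measurable_realfun ring zify.
Set Implicit Arguments. Unset Strict Implicit. Unset Printing Implicit Defensive.
Import Order.TTheory GRing.Theory Num.Theory.
Local Open Scope classical_set_scope.
Local Open Scope ring_scope.

(** * Unordered sums and their finite partial sums *)

Section FiniteSums.
Context {R : realType} {V : choiceType}.
Implicit Types (A : set V) (a : V -> \bar R).
Local Open Scope ereal_scope.

Lemma esum_le_seq A a (K : \bar R) :
  (forall s : seq V, uniq s -> (forall y, y \in s -> A y) ->
    \sum_(y <- s) a y <= K) ->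
  \esum_(y in A) a y <= K.
Proof.
move=> sK; apply: ge_ereal_sup => _ [F [finF FA] <-].
rewrite fsbig_finite//=; apply: sK; first exact: fset_uniq.
by move=> y; rewrite in_fset_set// inE => /FA.
Qed.

Lemma seq_le_esum A a (s : seq V) : uniq s -> (forall y, y \in s -> A y) ->
  \sum_(y <- s) a y <= \esum_(y in A) a y.
Proof.
move=> us sA; apply: esum_ge; exists [set` s].
  by split => //; exact: finite_seq.
by rewrite -fsbig_seq.
Qed.

End FiniteSums.

(** * Finite truncations of sectors and their generations *)

Section Descendants.
Context {V : choiceType} (par : V -> V) (hlf : par_locally_finite par).

(** [fset_set] returns the empty set on an infinite set; it is [hlf] that makes this list
    complete. *)
Definition children (x : V) : seq V := fset_set [set y | par y = x].

Lemma mem_children (x y : V) : (y \in children x) = (par y == x).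
Proof. by rewrite in_fset_set//; apply/idP/eqP => [|?]; rewrite inE. Qed.

Lemma uniq_children (x : V) : uniq (children x). Proof. exact: fset_uniq. Qed.

(** Sectors cut off at a finite depth. The recursion over children is what the inductions on depth
    follow. *)
Fixpoint descs (n : nat) (x : V) : seq V :=
  if n is n'.+1 then x :: [seq z | y <- children x, z <- descs n' y] else [::].

Fixpoint gens (n : nat) (x : V) : seq V :=
  if n is n'.+1 then [seq z | y <- children x, z <- gens n' y] else [:: x].

Lemma mem_descs (n : nat) (x z : V) :
  z \in descs n x <-> exists2 k, (k < n)%N & iter k par z = x.
Proof.
elim: n x z => [|n IH] x z; first by split=> // -[].
rewrite inE; split.
  case/orP => [/eqP->|]; first by exists 0%N.
  case/allpairsPdep => y [z' [/[!mem_children]/eqP yx z'y ->]].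
  have [k kn zy] := (IH y z').1 z'y.
  by exists k.+1; rewrite ?ltnS//= zy.
move=> [[_ /= ->|k]]; first by rewrite eqxx.
rewrite ltnS => kn /= zx; apply/orP; right; apply/allpairsPdep.
exists (iter k par z), z; split => //; first by rewrite mem_children zx.
by apply/IH; exists k.
Qed.

Lemma mem_gens (n : nat) (x z : V) : z \in gens n x <-> iter n par z = x.
Proof.
elim: n x z => [|n IH] x z; first by rewrite inE; split => /eqP.
split.
  case/allpairsPdep => y [z' [/[!mem_children]/eqP yx z'y ->]].
  by rewrite iterS ((IH y z').1 z'y).
move=> zx; apply/allpairsPdep; exists (iter n par z), z.
by split => //; [rewrite mem_children -zx|exact/IH].
Qed.

Context (lev : V -> int) (lev_par : forall y, lev (par y) = lev y + 1).

Lemma lev_iter (k : nat) (y : V) : lev (iter k par y) = lev y + k%:Z.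
Proof. by elim: k => [|k IH] /=; rewrite ?addr0// lev_par IH -addrA intS (addrC 1). Qed.

(** Siblings lie on one level, and the level counts the steps from [z], so [k = k']. Hence the
    sectors below distinct siblings are disjoint. *)
Lemma siblings_iter_inj (x y y' z : V) (k k' : nat) : par y = x -> par y' = x ->
  iter k par z = y -> iter k' par z = y' -> y = y'.
Proof.
move=> yx y'x zy zy'.
have : lev z + k%:Z = lev z + k'%:Z.
  by rewrite -!lev_iter zy zy'; apply: (addIr 1); rewrite -!lev_par yx y'x.
by move=> /addrI[kk']; rewrite -zy -zy' kk'.
Qed.

Lemma uniq_descs (n : nat) (x : V) : uniq (descs n x).
Proof.
elim: n x => [//|n IH] x /=; apply/andP; split.
  apply/negP => /allpairsPdep[y [z [/[!mem_children]/eqP yx zy xz]]].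
  move: zy; rewrite -xz => /mem_descs[k kn] xy.
  have : lev (par y) = lev x + (k%:Z + 1) by rewrite lev_par -xy lev_iter addrA.
  by rewrite yx -[LHS]addr0 => /addrI; lia.
apply: allpairs_uniq_dep; [exact: uniq_children|by move=> y _; exact: IH|].
move=> _ _ /allpairsPdep[y [z [yx zy ->]]] /allpairsPdep[y' [z' [yx' zy' ->]]] /= zz'.
move: zy'; rewrite -zz' => zy'; move: zy zy' yx yx'; rewrite !mem_children.
move=> /mem_descs[k _ zy] /mem_descs[k' _ zy'] /eqP yx /eqP yx'.
by rewrite (siblings_iter_inj yx yx' zy zy').
Qed.

Lemma uniq_gens (n : nat) (x : V) : uniq (gens n x).
Proof.
elim: n x => [//|n IH] x /=.
apply: allpairs_uniq_dep; [exact: uniq_children|by move=> y _; exact: IH|].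
move=> _ _ /allpairsPdep[y [z [yx zy ->]]] /allpairsPdep[y' [z' [yx' zy' ->]]] /= zz'.
move: zy'; rewrite -zz' => zy'; move: zy zy' yx yx'; rewrite !mem_children.
move=> /mem_gens zy /mem_gens zy' /eqP yx /eqP yx'.
by rewrite (siblings_iter_inj yx yx' zy zy').
Qed.

(** By connectedness two vertices have a common ancestor, and moving up to it only enlarges the
    sector. *)
Lemma descs_cofinal (hconn : par_connected par) (o : V) (s : seq V) :
  exists n x, {subset s <= descs n x}.
Proof.
elim: s => [|y s [n [x sx]]]; first by exists 0%N, o.
have [i [j yx]] := hconn x y.
(* The new top is [i] steps above [x] and [j] steps above [y]; [descs] bounds the depth strictly,
   hence [j.+1]. *)
exists (maxn (n + i) j.+1), (iter j par y) => z; rewrite inE => /orP[/eqP->|/sx].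
  by apply/mem_descs; exists j => //; rewrite leq_max ltnSn orbT.
move=> /mem_descs[k kn zx]; apply/mem_descs; exists (i + k)%N.
  by rewrite leq_max addnC ltn_add2r kn.
by rewrite iterD zx.
Qed.

Section Sums.
Context {R : realType}.
Implicit Types h : V -> R.

Lemma sum_descsS h n x : \sum_(z <- descs n.+1 x) h z =
  h x + \sum_(y <- children x) \sum_(z <- descs n y) h z.
Proof. by rewrite /= big_cons big_allpairs_dep. Qed.

Lemma sum_gensS h n x : \sum_(z <- gens n.+1 x) h z =
  \sum_(y <- children x) \sum_(z <- gens n y) h z.
Proof. by rewrite /= big_allpairs_dep. Qed.

(** This turns bounds uniform in the depth and the top vertex into bounds over the whole tree. *)
Lemma esum_le_descs (hconn : par_connected par) (o : V) h (K : \bar R) :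
  (forall y, 0 <= h y) ->
  (forall n x, ((\sum_(z <- descs n x) h z)%:E <= K)%E) ->
  (\esum_(y in [set: V]) (h y)%:E <= K)%E.
Proof.
move=> h0 hK; apply: esum_le_seq => s us _.
have [n [x sx]] := descs_cofinal hconn o s.
apply: le_trans (hK n x); rewrite -sumEFin.
apply: (le_trans (seq_le_esum (A := [set` descs n x]) (fun y => (h y)%:E) us sx)).
rewrite esum_fset; [|exact: finite_seq|by move=> y _; rewrite lee_fin].
by rewrite -fsbig_seq//; exact: uniq_descs.
Qed.

End Sums.
End Descendants.

(** * Strong and weak type estimates for abstract sector masses *)

Section CarlesonEmbedding.
Context {R : realType}.

(** The graph of the convex function [a ^ p] lies above its tangent at [s]. This is Young's
    inequality for [a] and [s ^ (p - 1)], multiplied by [p]. *)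
Lemma young_tangent (p a s : R) : 1 < p -> 0 <= a -> 0 <= s ->
  p * s `^ (p - 1) * a <= a `^ p + (p - 1) * s `^ p.
Proof.
move=> p1 a0 s0; have p0 : 0 < p by exact: lt_trans p1.
have p10 : 0 < p - 1 by rewrite subr_gt0.
have q0 : 0 < p / (p - 1) by exact: divr_gt0.
have pq : p^-1 + (p / (p - 1))^-1 = 1 by field; rewrite !gt_eqF.
have := conjugate_powR a0 (powR_ge0 s (p - 1)) p0 q0 pq.
rewrite -powRrM mulrCA divff ?gt_eqF// mulr1 -(ler_pM2l p0).
suff -> : p * (a `^ p / p + s `^ p / (p / (p - 1))) = a `^ p + (p - 1) * s `^ p.
  by rewrite -mulrA (mulrC a).
by field; rewrite !gt_eqF.
Qed.

Lemma powRB1M (p s : R) : 1 < p -> 0 <= s -> s `^ (p - 1) * s = s `^ p.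
Proof.
move=> p1 s0; rewrite -{2}(powRr1 s0) -powRD ?subrK//.
by rewrite gt_eqF//; exact: lt_trans p1.
Qed.

Context {V : choiceType} (par : V -> V).
Context (sigma m : V -> R).
Hypothesis sigma_ge0 : forall x, 0 <= sigma x.
Hypothesis m_gt0 : forall x, 0 < m x.
Hypothesis m_children : forall x, \sum_(y <- children par x) m y = m x.
Context (C : R).
Hypothesis C_ge0 : 0 <= C.
Hypothesis sigma_le : forall n x, \sum_(y <- descs par n x) sigma y <= C * m x.

(* Since [v * (u / v) ^ p] is the supremum over [s >= 0] of the functions
   [p s^(p-1) u - (p-1) s^p v], linear in (u, v), it is subadditive; taking the
   maximizing [s] at the parent leaves a surplus proportional to [sigma x]. *)
Lemma carleson_embedding_bellman (p : R) (u : V -> R) (n : nat) (x : V) :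
  let v n x := m x + \sum_(y <- descs par n x) sigma y in
  1 < p -> (forall x, 0 <= u x) ->
  (forall x, u x <= \sum_(y <- children par x) u y) ->
  \sum_(y <- descs par n x) (p - 1) * (sigma y * (u y / ((1 + C) * m y)) `^ p)
    + v n x * (u x / v n x) `^ p
  <= \sum_(y <- gens par n x) m y * (u y / m y) `^ p.
Proof.
move=> v p1 u0 uS; have p10 : 0 < p - 1 by rewrite subr_gt0.
have v0 k y : 0 < v k y by rewrite /v ltr_wpDr// sumr_ge0.
elim: n x => [|n IH] x.
  by rewrite /v /= !big_nil !big_seq1 addr0 add0r.
rewrite sum_descsS sum_gensS.
set w := v n.+1 x; set s := u x / w.
have w0 : 0 < w by exact: v0.
have s0 : 0 <= s by rewrite divr_ge0// ltW.
have wE : w = sigma x + \sum_(y <- children par x) v n y.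
  by rewrite /w /v sum_descsS big_split/= m_children addrCA.
apply: (@le_trans _ _ (\sum_(y <- children par x)
    (\sum_(z <- descs par n y) (p - 1) * (sigma z * (u z / ((1 + C) * m z)) `^ p)
      + v n y * (u y / v n y) `^ p))); last by apply: ler_sum => y _; exact: IH.
rewrite big_split/= addrAC addrC lerD2l.
apply: (@le_trans _ _ (\sum_(y <- children par x)
    (p * s `^ (p - 1) * u y - (p - 1) * s `^ p * v n y))); last first.
  apply: ler_sum => y _.
  have := young_tangent p1 (divr_ge0 (u0 y) (ltW (v0 n y))) s0.
  move=> /(ler_wpM2l (ltW (v0 n y))); rewrite mulrDr => yt.
  have -> : p * s `^ (p - 1) * u y = v n y * (p * s `^ (p - 1) * (u y / v n y)).
    by field; rewrite gt_eqF.
 by rewrite lerBlDr [X in _ <= _ + X]mulrC.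
rewrite big_split/= sumrN -!mulr_sumr.
have -> : \sum_(y <- children par x) v n y = w - sigma x by rewrite wE addrAC subrr add0r.
apply: (@le_trans _ _ (p * s `^ (p - 1) * u x - (p - 1) * s `^ p * (w - sigma x))).
  have -> : u x = s * w by rewrite /s divfK// gt_eqF.
  have -> : p * s `^ (p - 1) * (s * w) = p * s `^ p * w.
    by rewrite -(powRB1M p1 s0); ring.
  have -> : p * s `^ p * w - (p - 1) * s `^ p * (w - sigma x) =
    w * s `^ p + (p - 1) * (sigma x * s `^ p) by ring.
  (* It remains to compare [u x / ((1 + C) * m x)] with [s = u x / w]. The Carleson bound gives
     [w <= (1 + C) * m x], which is the source of the factor [1 + C]. *)
  rewrite addrC lerD2l ler_pM2l// ler_wpM2l//.
  have C1m : 0 < (1 + C) * m x by rewrite mulr_gt0// ltr_pwDl.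
  apply: ge0_ler_powR; rewrite ?nnegrE//.
  - by rewrite ltW// (lt_trans _ p1).
  - exact: divr_ge0 (mulr_ge0 s0 (ltW w0)) (ltW C1m).
  - by rewrite ler_pdivrMr// ler_wpM2l// /w /v mulrDl mul1r lerD2l.
by rewrite lerD2r ler_wpM2l// mulr_ge0 ?powR_ge0// ltW// (lt_trans _ p1).
Qed.

(** The nonnegative Bellman term at [x] is dropped, and homogeneity moves [1 + C] into the
    constant. *)
Lemma carleson_embedding (p : R) (u : V -> R) (n : nat) (x : V) :
  1 < p -> (forall x, 0 <= u x) ->
  (forall x, u x <= \sum_(y <- children par x) u y) ->
  \sum_(y <- descs par n x) (u y / m y) `^ p * sigma y
  <= (1 + C) `^ p / (p - 1) * \sum_(y <- gens par n x) (u y / m y) `^ p * m y.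
Proof.
move=> p1 u0 uS; have p10 : 0 < p - 1 by rewrite subr_gt0.
have C1 : 0 < 1 + C by rewrite ltr_pwDl.
have C1p : 0 < (1 + C) `^ p by exact: powR_gt0.
set A := (X in X <= _); under [X in _ * X]eq_bigr do rewrite mulrC.
have := carleson_embedding_bellman n x p1 u0 uS.
set G := (X in _ <= X -> _).
have -> : \sum_(y <- descs par n x)
    (p - 1) * (sigma y * (u y / ((1 + C) * m y)) `^ p) = (p - 1) / (1 + C) `^ p * A.
  rewrite /A mulr_sumr; apply: eq_bigr => y _.
  have -> : u y / ((1 + C) * m y) = (1 + C)^-1 * (u y / m y).
    by rewrite invfM mulrCA.
  rewrite (@powRM _ (1 + C)^-1) ?invr_ge0 ?divr_ge0 ?(ltW C1) ?(ltW (m_gt0 y))//.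
  by rewrite -(powR_inv1 (ltW C1)) -powRrM mulN1r powRN; ring.
move=> AG; have {}AG : (p - 1) / (1 + C) `^ p * A <= G.
  apply: le_trans AG; rewrite lerDl mulr_ge0 ?powR_ge0//.
  by rewrite addr_ge0 ?sumr_ge0// ltW.
by rewrite -ler_pdivrMl ?divr_gt0// invf_div.
Qed.

(** The inequality for [u] runs opposite to that in [carleson_embedding], since here the children's
    bounds [C * u y] must add up to at most [C * u x]. *)
Lemma carleson_weak_type (u : V -> R) (lam : R) (n : nat) (x : V) :
  0 < lam ->
  (forall x, \sum_(y <- children par x) u y <= u x) -> (forall x, 0 <= u x) ->
  lam * \sum_(y <- descs par n x | lam * m y < u y) sigma y <= C * u x.
Proof.
move=> lam0 uS u0; elim: n x => [|n IH] x.
  by rewrite big_nil mulr0 mulr_ge0.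
have [xl|xl] := ltP (lam * m x) (u x).
  (* The induction stops at [x]: even the whole truncated sector has mass at most [C * m x], and
     [lam * m x < u x]. *)
  apply: (@le_trans _ _ (lam * (C * m x))).
    rewrite ler_wpM2l ?(ltW lam0)//; apply: le_trans (sigma_le n.+1 x).
    by rewrite big_mkcond/=; apply: ler_sum => y _; case: ifP.
  by rewrite mulrCA ler_wpM2l// ltW.
rewrite big_mkcond sum_descsS ltNge xl/= add0r.
under eq_bigr do rewrite -big_mkcond/=.
apply: (@le_trans _ _ (\sum_(y <- children par x) C * u y)).
  by rewrite mulr_sumr; apply: ler_sum => y _; exact: IH.
by rewrite -mulr_sumr ler_wpM2l.
Qed.

End CarlesonEmbedding.

(** * Boundary sectors, Poisson integrals and Jensen's inequality *)

Section PoissonIntegral.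
Context {R : realType} {V : choiceType} {par : V -> V} {o : V} {w0 : Bd par o}.
Context (nu : {measure set BdM w0 -> \bar R}).
Hypothesis nu_fin : forall x : V, (0 < m_nu nu x)%E /\ (m_nu nu x < +oo)%E.

Local Notation sB x := (sectorB x : set (BdM w0)).

Lemma measurable_sectorB (x : V) : measurable (sB x).
Proof. by apply: sub_sigma_algebra; exists x. Qed.

Lemma sectorB_neq0 (x : V) : exists w : BdM w0, sB x w.
Proof.
apply/set0P/eqP => x0; have [] := nu_fin x.
by rewrite /m_nu x0 measure0 ltxx.
Qed.

Lemma sectorB_level (x : V) (w : BdM w0) (k : int) : sval w k = x -> level par o x = k.
Proof. by move=> <-; have [] := svalP w k. Qed.

(** A sector of positive mass contains a geodesic, and geodesics in [Bd] are enumerated by level;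
    the choice made by [xget] need not be unfolded. *)
Lemma level_par (x : V) : level par o (par x) = level par o x + 1.
Proof.
have [w [k wk]] := sectorB_neq0 x; rewrite (sectorB_level wk).
by apply: (@sectorB_level _ w); rewrite -wk; have [] := svalP w k.
Qed.

Lemma sectorB_par (x : V) : sB x `<=` sB (par x).
Proof. by move=> w [k <-]; exists (k + 1); have [] := svalP w k. Qed.

Lemma sectorB_iter (n : nat) (x : V) : sB x `<=` sB (iter n par x).
Proof. by elim: n => [//|n IH] /=; exact: subset_trans IH (@sectorB_par _). Qed.

(** A geodesic meets each level in a single vertex. *)
Lemma trivIset_sectorB (k : int) (s : seq V) :
  (forall y, y \in s -> level par o y = k) -> trivIset [set` s] (fun y => sB y).
Proof.
move=> sk; apply/trivIsetP => x y /= xs ys xy; apply/seteqP; split => // w [[i wi] [j wj]].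
move/eqP: xy; apply; rewrite -wi -wj.
by rewrite -(sectorB_level wi) -(sectorB_level wj) !sk.
Qed.

Lemma m_nu_fine (x : V) : (fine (m_nu nu x))%:E = m_nu nu x.
Proof. by rewrite fineK// ge0_fin_numE; have [? ?] := nu_fin x; rewrite // ltW. Qed.

Lemma fine_m_nu_gt0 (x : V) : 0 < fine (m_nu nu x).
Proof. by rewrite -lte_fin m_nu_fine; have [] := nu_fin x. Qed.

(** On this class the integrals over sectors are finite, so [fine] in [Poisson] hides no infinite
    value. *)
Definition locally_integrable (f : BdM w0 -> R) :=
  forall x, nu.-integrable (sB x) (EFin \o f).

Lemma normr_Poisson (f : BdM w0 -> R) (x : V) :
  `|Poisson nu f x| = `|\int[nu]_(w in sB x) f w| / fine (m_nu nu x).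
Proof. by rewrite /Poisson normrM normfV (gtr0_norm (fine_m_nu_gt0 x)). Qed.

Section Children.
Hypothesis hlf : par_locally_finite par.

Lemma level_children (x y : V) : y \in children par x -> level par o y = level par o x - 1.
Proof. by rewrite mem_children// => /eqP <-; rewrite level_par addrK. Qed.

(** A geodesic through [x] at index [k] passes through a child of [x] at index [k - 1]. *)
Lemma sectorB_children (x : V) :
  sB x = \big[setU/set0]_(y <- children par x) sB y.
Proof.
rewrite -bigcup_seq; apply/seteqP; split => [w [k wk]|w [y /= yx]].
  exists (sval w (k - 1)); last by exists (k - 1).
  rewrite /= mem_children//; apply/eqP.
  by rewrite -wk; have [-> _] := svalP w (k - 1); rewrite subrK.
by move: yx; rewrite mem_children// => /eqP <- /sectorB_par.
Qed.

Lemma Rintegral_children (f : BdM w0 -> R) (x : V) : locally_integrable f ->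
  \int[nu]_(w in sB x) f w = \sum_(y <- children par x) \int[nu]_(w in sB y) f w.
Proof.
move=> fi; rewrite /Rintegral sum_fine => [|y _]; last first.
  by have := integrable_fin_num (measurable_sectorB y) (fi y).
congr fine; rewrite {1}sectorB_children integral_bigsetU_EFin//.
- exact: measurable_sectorB.
- exact: uniq_children.
- exact: trivIset_sectorB (@level_children x).
- by rewrite -sectorB_children; exact: measurable_int (fi x).
Qed.

(** Additivity of the integral over children, applied to the constant 1. *)
Lemma m_nu_children (x : V) :
  \sum_(y <- children par x) fine (m_nu nu y) = fine (m_nu nu x).
Proof.
have c1 : locally_integrable (cst 1).
  move=> y; apply/integrableP; split => /=; first by apply/measurable_EFinP; exact: measurable_cst.
  rewrite normr1 (integral_cst _ (measurable_sectorB y)) mul1e.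
  by have [] := nu_fin y.
have E y : \int[nu]_(w in sB y) cst 1 w = fine (m_nu nu y).
  by rewrite /Rintegral (integral_cst _ (measurable_sectorB y) 1%:E) mul1e.
by rewrite -E Rintegral_children//; apply: eq_bigr => y _; rewrite E.
Qed.

End Children.

Section Lp.
Context (p : R) (f : BdM w0 -> R).
Hypothesis p1 : 1 < p.
Hypothesis mf : measurable_fun setT f.

Lemma measurable_normr_powR : measurable_fun setT (fun w => (`|f w| `^ p)%:E).
Proof.
apply/measurable_EFinP; apply: (measurableT_comp (measurable_powR p)).
exact: measurableT_comp.
Qed.

(** [young_tangent] integrated over the sector. Taking [s = 1] yields local integrability, and
    [s = |Pf(x)|] yields Jensen's inequality. *)
Lemma integral_young_tangent (s : R) (x : V) : 0 <= s ->
  ((p * s `^ (p - 1))%:E * \int[nu]_(w in sB x) `|(f w)%:E|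
   <= \int[nu]_(w in sB x) (`|f w| `^ p)%:E + ((p - 1) * s `^ p)%:E * m_nu nu x)%E.
Proof.
move=> s0; have p0 : 0 <= p - 1 by rewrite subr_ge0 ltW.
have mS := measurable_sectorB x.
have mfS : measurable_fun (sB x) f by exact: measurable_funS mf.
have ps0 : 0 <= p * s `^ (p - 1) by rewrite mulr_ge0 ?powR_ge0// ltW// (lt_trans _ p1).
have mp : measurable_fun (sB x) (fun w => (`|f w| `^ p)%:E).
  exact: measurable_funS measurable_normr_powR.
have ma : measurable_fun (sB x) (fun w => `|(f w)%:E|%E).
  by apply: measurableT_comp => //; exact/measurable_EFinP.
rewrite -(integral_cst _ mS) -ge0_integralZl_EFin// -ge0_integralD//;
  [|by move=> w _; rewrite lee_fin ?mulr_ge0 ?powR_ge0..].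
apply: ge0_le_integral => //.
- by move=> w _; rewrite mule_ge0// lee_fin.
- exact: measurable_funeM.
- exact: emeasurable_funD.
- by move=> w _; rewrite /= -EFinM -EFinD lee_fin young_tangent.
Qed.

Hypothesis fp : ('N[nu]_(p%:E)[EFin \o f] < +oo)%E.

Lemma poweR_Lnorm_EFin :
  ('N[nu]_(p%:E)[EFin \o f] `^ p = \int[nu]_w (`|f w| `^ p)%:E)%E.
Proof. by rewrite poweR_Lnorm// gt_eqF// (lt_trans _ p1). Qed.

Lemma sector_integral_le_Lnorm (x : V) :
  (\int[nu]_(w in sB x) (`|f w| `^ p)%:E <= 'N[nu]_(p%:E)[EFin \o f] `^ p)%E.
Proof.
rewrite poweR_Lnorm_EFin; apply: ge0_subset_integral => //.
- exact: measurable_sectorB.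
- exact: measurable_normr_powR.
Qed.

Lemma Lp_locally_integrable : locally_integrable f.
Proof.
move=> x; apply/integrableP; split.
  by apply/measurable_EFinP; exact: measurable_funS mf.
have := integral_young_tangent x ler01; rewrite powR1 /= !mulr1 => h.
have : (p%:E * \int[nu]_(w in sB x) `|(f w)%:E| < +oo)%E.
  apply: le_lt_trans h _; apply: lte_add_pinfty.
    by apply: le_lt_trans (sector_integral_le_Lnorm x) _; exact: poweR_lty.
  by rewrite -m_nu_fine -EFinM ltry.
by rewrite -lte_pdivlMl ?gt0_muley ?lte_fin ?invr_gt0 ?(lt_trans _ p1).
Qed.

Lemma Poisson_jensen (x : V) :
  ((`|Poisson nu f x| `^ p)%:E * m_nu nu x <= \int[nu]_(w in sB x) (`|f w| `^ p)%:E)%E.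
Proof.
set s := `|Poisson nu f x|.
have s0 : 0 <= s by exact: normr_ge0.
have h := integral_young_tangent x s0.
have sm : (s%:E * m_nu nu x <= \int[nu]_(w in sB x) `|(f w)%:E|)%E.
  rewrite -m_nu_fine -EFinM /s normr_Poisson divfK ?gt_eqF ?fine_m_nu_gt0//.
  have fi := Lp_locally_integrable x.
  have := le_normr_Rintegral (measurable_sectorB x) fi; rewrite -lee_fin => /le_trans; apply.
  rewrite /Rintegral fineK//.
  by have := integrable_fin_num (measurable_sectorB x) (integrable_norm fi).
have ps0 : (0 <= (p * s `^ (p - 1))%:E)%E.
  by rewrite lee_fin mulr_ge0 ?powR_ge0// ltW// (lt_trans _ p1).
have := le_trans (lee_wpmul2l ps0 sm) h.
(* The left side is now [p * s ^ p * m_nu x]; subtracting [(p - 1) * s ^ p * m_nu x] leaves the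
   claim. *)
rewrite muleA -EFinM -mulrA powRB1M//.
rewrite -m_nu_fine -!EFinM -leeBlDr// -EFinB.
by congr (_ <= _)%E; congr EFin; ring.
Qed.

(** Jensen's inequality is summed over vertices of one level, whose boundary sectors are
    disjoint. *)
Lemma Hp_Poisson_le : (Hp nu p (Poisson nu f) <= 'N[nu]_(p%:E)[EFin \o f])%E.
Proof.
have p0 : 0 < p by exact: lt_trans p1.
have mp := measurable_normr_powR.
rewrite unlock /Lnorm; apply: gt0_ler_poweR.
- by rewrite invr_ge0 ltW.
- rewrite in_itv/= leey andbT; apply: le_trans (ereal_sup_ubound _); last by exists 0.
  by apply: esum_ge0 => x _; rewrite mule_ge0// lee_fin powR_ge0.
- by rewrite in_itv/= leey andbT integral_ge0// => w _; rewrite poweR_ge0.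
- apply: ge_ereal_sup => _ [k _ <-]; apply: esum_le_seq => s us sk.
  apply: (@le_trans _ _ (\sum_(x <- s) \int[nu]_(w in sB x) (`|f w| `^ p)%:E)%E).
    by apply: lee_sum => x _; exact: Poisson_jensen.
  rewrite -ge0_integral_bigsetU//.
  - apply: (@le_trans _ _ (\int[nu]_w (`|f w| `^ p)%:E)%E).
      apply: ge0_subset_integral => //.
      by apply: bigsetU_measurable => x _; exact: measurable_sectorB.
    by rewrite le_eqVlt; apply/orP; left; apply/eqP; exact: eq_integral.
  - exact: measurable_sectorB.
  - exact: trivIset_sectorB sk.
  - exact: measurable_funS mp.
Qed.

End Lp.
End PoissonIntegral.

(** * Carleson measures and bounds for the Poisson integral *)

Section CarlesonMeasures.
Context {R : realType} {V : choiceType} {par : V -> V} {o : V} {w0 : Bd par o}.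
Context (hconn : par_connected par) (hlf : par_locally_finite par).
Context (nu : {measure set BdM w0 -> \bar R}).
Hypothesis nu_fin : forall x : V, (0 < m_nu nu x)%E /\ (m_nu nu x < +oo)%E.
Context (sigma : V -> R).
Hypothesis sigma_ge0 : forall x, 0 <= sigma x.

Local Notation sB x := (sectorB x : set (BdM w0)).
Local Notation M x := (fine (m_nu nu x)).

Lemma descs_sigma_le (C : R) (n : nat) (x : V) :
  (forall x, smeas sigma (sectorT par x) <= C%:E * m_nu nu x)%E ->
  \sum_(y <- descs par n x) sigma y <= C * M x.
Proof.
move=> sC; rewrite -lee_fin EFinM m_nu_fine// -sumEFin; apply: le_trans (sC x).
apply: seq_le_esum; first by apply: uniq_descs; [exact: hlf|exact: level_par nu_fin].
by move=> y /(mem_descs hlf)[k _ yx]; exists k.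
Qed.

Lemma Carleson_LpT_le_Hp (p : R) : 1 < p -> Carleson nu sigma ->
  exists Cp : R, 0 < Cp /\ forall f : BdM w0 -> R, locally_integrable nu f ->
    (LpT sigma p (Poisson nu f) <= Cp%:E * Hp nu p (Poisson nu f))%E.
Proof.
move=> p1 [C [C0 sC]]; set K := (1 + C) `^ p / (p - 1).
have K0 : 0 < K by rewrite divr_gt0 ?subr_gt0// powR_gt0// addr_gt0.
exists (K `^ p^-1); split; first exact: powR_gt0.
move=> f fi; rewrite /LpT /Hp; set S := ereal_sup _.
have S0 : (0 <= S)%E.
  apply: le_trans (ereal_sup_ubound _); last by exists 0.
  by apply: esum_ge0 => x _; rewrite mule_ge0 ?lee_fin ?powR_ge0.
rewrite -poweR_EFin -poweRM ?lee_fin ?(ltW K0)//; apply: gt0_ler_poweR.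
- by rewrite invr_ge0 ltW// (lt_trans _ p1).
- rewrite in_itv/= leey andbT; apply: esum_ge0 => x _.
  by rewrite lee_fin mulr_ge0// powR_ge0.
- by rewrite in_itv/= leey andbT mule_ge0// lee_fin ltW.
apply: (esum_le_descs hlf (level_par nu_fin) hconn o).
  by move=> y; rewrite mulr_ge0// powR_ge0.
(* With the modulus outside the integral, [u y / m_nu y] is exactly [|Pf(y)|], and the triangle
   inequality over the children gives the bound required of [u]. *)
move=> n x; pose u y := `|\int[nu]_(w in sB y) f w|.
have uS y : u y <= \sum_(z <- children par y) u z.
  by rewrite /u (Rintegral_children nu_fin hlf) ?ler_norm_sum.
have := carleson_embedding sigma_ge0 (fine_m_nu_gt0 nu_fin)
  (m_nu_children nu_fin hlf) (ltW C0) (fun n x => descs_sigma_le n x sC)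
  n x p1 (fun y => normr_ge0 _) uS.
rewrite -/K -lee_fin; under eq_bigr do rewrite /u -(normr_Poisson nu_fin).
move=> /le_trans; apply; rewrite EFinM lee_wpmul2l ?lee_fin ?(ltW K0)//.
(* The [n]-th generation below [x] lies on the level of [x] minus [n], so its sum is bounded by one
   term of the [H^p] supremum. *)
apply: (@le_trans _ _ (\esum_(y in [set y | level par o y = level par o x - n%:Z])
    ((`|Poisson nu f y| `^ p)%:E * m_nu nu y)%E)); last first.
  by apply: ereal_sup_ubound; exists (level par o x - n%:Z).
rewrite -sumEFin.
under eq_bigr do rewrite /u -(normr_Poisson nu_fin) EFinM (m_nu_fine nu_fin).
apply: seq_le_esum; first by apply: uniq_gens; [exact: hlf|exact: level_par nu_fin].
move=> y /(mem_gens hlf) <-.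
by rewrite /= (lev_iter (level_par nu_fin)) addrK.
Qed.

Lemma Carleson_LweakT_le_L1 : Carleson nu sigma ->
  exists C : R, 0 < C /\ forall f : BdM w0 -> R, measurable_fun setT f ->
    ('N[nu]_(1%:E)[EFin \o f] < +oo)%E ->
    (LweakT sigma (Poisson nu f) <= C%:E * 'N[nu]_(1%:E)[EFin \o f])%E.
Proof.
move=> [C [C0 sC]]; exists C; split=> // f mf; rewrite Lnorm1 => f1.
have mf' : measurable_fun setT (EFin \o f) by exact/measurable_EFinP.
have fi : locally_integrable nu f.
  move=> x; apply: (@integrableS _ _ _ nu setT) => //.
    exact: measurable_sectorB.
  by apply/integrableP.
(* Now the modulus is inside: this [u] is additive over children, as the weak type lemma requires,
   and it dominates the modulus of the integral of [f]. *)
pose u x := \int[nu]_(w in sB x) `|f w|.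
have uE x : ((u x)%:E = \int[nu]_(w in sB x) `|(f w)%:E|)%E.
  rewrite /u /Rintegral fineK//.
  by have := integrable_fin_num (measurable_sectorB x) (integrable_norm (fi x)).
apply: ge_ereal_sup => _ [lam lam0 <-].
rewrite -lee_pdivlMl// /smeas esum_mkcond.
(* Extending by zero off the level set gives a sum over all of [V], to which [esum_le_descs]
   applies. *)
pose h y := if lam < `|Poisson nu f y| then sigma y else 0.
rewrite (eq_esum (b := fun y => (h y)%:E)); last first.
  move=> y _; rewrite /h; case: ifPn => [/set_mem /= ->//|].
  by rewrite notin_setE /= => /negP/negbTE ->.
have h0 y : 0 <= h y by rewrite /h; case: ifP.
apply: (esum_le_descs hlf (level_par nu_fin) hconn o h0) => n x.
rewrite lee_pdivlMl// -EFinM.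
apply: (@le_trans _ _ (C * u x)%:E); last first.
  rewrite EFinM uE lee_wpmul2l ?lee_fin ?(ltW C0)//.
  apply: ge0_subset_integral => //; first exact: measurable_sectorB.
  exact: measurableT_comp.
rewrite lee_fin; apply: (@le_trans _ _
    (lam * \sum_(y <- descs par n x | lam * M y < u y) sigma y)).
  rewrite ler_wpM2l ?(ltW lam0)// [leRHS]big_mkcond/=; apply: ler_sum => y _.
  rewrite /h (normr_Poisson nu_fin) ltr_pdivlMr ?(fine_m_nu_gt0 nu_fin)//.
  case: ifPn => [Hl|_]; last by case: ifP.
  rewrite (lt_le_trans Hl)//.
  exact: le_normr_Rintegral (measurable_sectorB y) (fi y).
apply: (carleson_weak_type sigma_ge0 (ltW C0) (fun n x => descs_sigma_le n x sC)) => //.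
  move=> y; rewrite /u (Rintegral_children nu_fin hlf)//.
  by move=> z; exact: integrable_norm (fi z).
by move=> y; rewrite -lee_fin uE; apply: integral_ge0.
Qed.

(** The inequality is tested on the indicator of a boundary sector: its Poisson integral is 1 on
    [sectorT par x], and the [p]-th power of its norm is [m_nu nu x]. *)
Lemma LpT_le_Lp_Carleson (p Cp : R) : 1 < p -> 0 < Cp ->
  (forall f : BdM w0 -> R, measurable_fun setT f ->
    ('N[nu]_(p%:E)[EFin \o f] < +oo)%E ->
    (LpT sigma p (Poisson nu f) <= Cp%:E * 'N[nu]_(p%:E)[EFin \o f])%E) ->
  Carleson nu sigma.
Proof.
move=> p1 Cp0 H; exists (Cp `^ p); split; first exact: powR_gt0.
have p0 : 0 < p by exact: lt_trans p1.
move=> x; pose f : BdM w0 -> R := \1_(sB x).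
have mS : measurable (sB x) by exact: measurable_sectorB.
have mf : measurable_fun setT f by exact: measurable_indic.
have Np : ('N[nu]_(p%:E)[EFin \o f] `^ p = m_nu nu x)%E.
  have := integral_indic nu measurableT mS; rewrite setIT /m_nu => <-.
  rewrite (poweR_Lnorm_EFin _ _ p1).
  apply: eq_integral => w _; congr EFin; rewrite /f indicE.
  by case: (w \in _); rewrite ?normr1 ?normr0 ?powR1 ?powR0 ?gt_eqF.
(* The norm is written as the [1/p]-th power of its [p]-th power, which is the finite mass of the
   sector. *)
have Nfin : ('N[nu]_(p%:E)[EFin \o f] < +oo)%E.
  rewrite -(@poweRe1 _ 'N[nu]_(p%:E)[EFin \o f]) ?Lnorm_ge0//.
  rewrite -(divff (lt0r_neq0 p0)) poweRrM Np poweR_lty//.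
  by have [] := nu_fin x.
have P1 y : sectorT par x y -> Poisson nu f y = 1.
  move=> [n yx]; rewrite /Poisson (integral_indic _ (measurable_sectorB y) mS).
  have /setIidr -> : sB y `<=` sB x by rewrite -yx; exact: sectorB_iter.
  by rewrite divff// gt_eqF// (fine_m_nu_gt0 nu_fin).
have L0 : (0 <= LpT sigma p (Poisson nu f))%E by exact: poweR_ge0.
have : (LpT sigma p (Poisson nu f) `^ p <= (Cp%:E * 'N[nu]_(p%:E)[EFin \o f]) `^ p)%E.
  apply: gt0_ler_poweR; rewrite ?in_itv/= ?leey ?andbT ?(ltW p0)//.
    by rewrite mule_ge0 ?Lnorm_ge0// lee_fin ltW.
  exact: H.
rewrite poweRM ?Lnorm_ge0 ?lee_fin ?(ltW Cp0)// Np poweR_EFin; apply: le_trans.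
have h0 y : 0 <= `|Poisson nu f y| `^ p * sigma y by rewrite mulr_ge0// powR_ge0.
rewrite /LpT -poweRrM mulVf ?gt_eqF// poweRe1; last first.
  by apply: esum_ge0 => y _; rewrite lee_fin.
rewrite /smeas esum_mkcond; apply: le_esum => y _.
case: ifPn => [/set_mem /P1 ->|_]; last by rewrite lee_fin.
by rewrite normr1 powR1 /= mul1r.
Qed.

End CarlesonMeasures.

(** * The equivalence of the three conditions *)

Unset Implicit Arguments.

Theorem theorem2p4 (R : realType) (V : choiceType) (par : V -> V) (o : V)
  (htree : is_tree_with_end par) (hlf : par_locally_finite par)
  (w0 : Bd par o) (nu : {measure set BdM w0 -> \bar R})
  (hnu : forall x : V, (0 < m_nu nu x)%E /\ (m_nu nu x < +oo)%E)
  (sigma : V -> R) (hsigma : forall x : V, 0 <= sigma x) :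
  (Carleson nu sigma <->
    ((forall p : R, 1 < p -> exists Cp : R, 0 < Cp /\
        forall f : BdM w0 -> R, measurable_fun setT f ->
          ('N[nu]_(p%:E)[EFin \o f] < +oo)%E ->
          (LpT sigma p (Poisson nu f) <= Cp%:E * 'N[nu]_(p%:E)[EFin \o f])%E)
     /\ (exists C : R, 0 < C /\
        forall f : BdM w0 -> R, measurable_fun setT f ->
          ('N[nu]_(1%:E)[EFin \o f] < +oo)%E ->
          (LweakT sigma (Poisson nu f) <= C%:E * 'N[nu]_(1%:E)[EFin \o f])%E)))
  /\
  (Carleson nu sigma <->
    (forall p : R, 1 < p -> exists Cp : R, 0 < Cp /\
        forall f : BdM w0 -> R, measurable_fun setT f ->
          ('N[nu]_(p%:E)[EFin \o f] < +oo)%E ->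
          (LpT sigma p (Poisson nu f) <= Cp%:E * Hp nu p (Poisson nu f))%E)).
Proof.
have [hconn _] := htree.
have LpT_Lp : Carleson nu sigma -> forall p : R, 1 < p -> exists Cp : R, 0 < Cp /\
    forall f : BdM w0 -> R, measurable_fun setT f ->
      ('N[nu]_(p%:E)[EFin \o f] < +oo)%E ->
      (LpT sigma p (Poisson nu f) <= Cp%:E * 'N[nu]_(p%:E)[EFin \o f])%E.
  move=> hC p p1.
  have [Cp [Cp0 H]] := Carleson_LpT_le_Hp hconn hlf hnu hsigma p1 hC.
  exists Cp; split=> // f mf fp.
  apply: le_trans (H f (Lp_locally_integrable hnu p1 mf fp)) _.
  by rewrite lee_wpmul2l ?lee_fin ?(ltW Cp0)//; exact: Hp_Poisson_le.
(* A single exponent recovers the Carleson condition; both converses use [p = 2]. *)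
have two_gt1 : 1 < 2 :> R by rewrite ltr1n.
split; split.
- by move=> hC; split; [exact: LpT_Lp|exact: Carleson_LweakT_le_L1].
- move=> [/(_ _ two_gt1)[Cp [Cp0 H]] _].
  by apply: (LpT_le_Lp_Carleson hnu hsigma two_gt1 Cp0) => f mf fp; exact: H.
- move=> hC p p1.
  have [Cp [Cp0 H]] := Carleson_LpT_le_Hp hconn hlf hnu hsigma p1 hC.
  exists Cp; split=> // f mf fp.
  exact: H (Lp_locally_integrable hnu p1 mf fp).
- move=> /(_ _ two_gt1)[Cp [Cp0 H]].
  apply: (LpT_le_Lp_Carleson hnu hsigma two_gt1 Cp0) => f mf fp.
  (* The [H^p] norm is at most the [L^p] norm, so (iii) at [p = 2] implies the bound of (ii) at
     [p = 2]. *)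
  apply: le_trans (H f mf fp) _.
  by rewrite lee_wpmul2l ?lee_fin ?(ltW Cp0)//; exact: Hp_Poisson_le.
Qed.
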